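(* For every $w \in \mathrm{Br}_3$, all four entries of the matrix $B_{-t}(w)$ are definite Laurent polynomials. Moreover, the trace $\mathrm{tr}\big(B_{-t}(w)\big)$ is definite.
   Context: $\mathrm{Br}_3 = \langle \sigma_1, \sigma_2 \mid \sigma_1\sigma_2\sigma_1 = \sigma_2\sigma_1\sigma_2\rangle$ is the 3-strand braid group. The reduced Burau representation $B_t : \mathrm{Br}_3 \to \mathrm{GL}_2(\mathbb{Z}[t^{\pm1}])$ is given by $B_t(\sigma_1) = \begin{pmatrix} -t & 1\\ 0 & 1\end{pmatrix}$, $B_t(\sigma_2) = \begin{pmatrix} 1 & 0 \\ t & -t\end{pmatrix}$; $B_{-t}(w)$ is obtained from $B_t(w)$ by substituting $-t$ for $t$. A Laurent polynomial $p(t)\in\mathbb{Z}[t^{\pm1}]$ is definite when all its nonzero coefficients have the same sign (so $0$ is definite). *)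

(* Defs.v *)
From HB Require Import structures.
From mathcomp Require Import all_boot all_order all_algebra generic_quotient.
From mathcomp Require Import finmap boolp.
From mathcomp Require Import monalg ring.

Set Implicit Arguments.
Unset Strict Implicit.
Unset Printing Implicit Defensive.

Import Order.TTheory GRing.Theory Num.Theory.
Local Open Scope ring_scope.

(* The ring Z[t, t^-1]. The library's {malg int[K]} carries a ring structure
   only when K is a monoid without nontrivial units, which excludes the
   exponents K = int; hence the additive group is the library's, and the
   convolution product is defined here. *)

Definition laurent : Type := {malg int[int]}.
HB.instance Definition _ := GRing.Zmodule.on laurent.

(* coefficient of t^k *)
Definition lcoef (k : int) (p : laurent) : int := mcoeff k p.

(* the monomial c t^k *)
Definition lmono (k c : int) : laurent := mkmalgU k c.

Definition lsupp (p : laurent) : {fset int} := msupp p.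

HB.lock Definition lmul (p q : laurent) : laurent :=
  \sum_(i <- lsupp p) \sum_(j <- lsupp q) lmono (i + j) (lcoef i p * lcoef j q).

Fact lcoef_additive k : zmod_morphism (lcoef k : laurent -> int).
Proof. by move=> p q; rewrite /lcoef mcoeffB. Qed.
HB.instance Definition _ k :=
  GRing.isZmodMorphism.Build laurent int (lcoef k) (lcoef_additive k).

Fact lmono_additive k : zmod_morphism (lmono k : int -> laurent).
Proof. by move=> a b; rewrite /lmono monalgUB. Qed.
HB.instance Definition _ k :=
  GRing.isZmodMorphism.Build int laurent (lmono k) (lmono_additive k).

Lemma laurentP (p q : laurent) : (forall k, lcoef k p = lcoef k q) <-> p = q.
Proof. exact: malgP. Qed.

Lemma lcoef_mono c k i : lcoef i (lmono k c) = c *+ (k == i).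
Proof. exact: mcoeffU. Qed.

Lemma lmono0 k : lmono k 0 = 0.
Proof. exact: raddf0. Qed.

Lemma lmonoD a b k : lmono k (a + b) = lmono k a + lmono k b.
Proof. exact: raddfD. Qed.

Lemma lsupp_mono_le c k : (lsupp (lmono k c) `<=` [fset k])%fset.
Proof. exact: msuppU_le. Qed.

Lemma mem_lsupp k p : (k \in lsupp p) = (lcoef k p != 0).
Proof. by rewrite mcoeff_neq0. Qed.

Lemma lcoef_out k p : k \notin lsupp p -> lcoef k p = 0.
Proof. exact: mcoeff_outdom. Qed.

Lemma laurentEw (p : laurent) (d : {fset int}) :
  (lsupp p `<=` d)%fset -> p = \sum_(k <- d) lmono k (lcoef k p).
Proof. exact: monalgEw. Qed.

Lemma laurentE (p : laurent) : p = \sum_(k <- lsupp p) lmono k (lcoef k p).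
Proof. exact: monalgE. Qed.

Lemma laurent_ind (P : laurent -> Prop) :
  P 0 -> (forall p q, P p -> P q -> P (p + q)) -> (forall k c, P (lmono k c)) ->
  forall p, P p.
Proof.
by move=> P0 PD Pm p; rewrite [p]laurentE; apply: big_ind => // i _; apply: Pm.
Qed.

(* a Z-linear expression in the coefficients can be summed over any finite set
   containing the support *)
Lemma lsupp_sumw (V : zmodType) (f : int -> int -> V) (p : laurent)
    (d : {fset int}) :
  (forall k, f k 0 = 0) -> (lsupp p `<=` d)%fset ->
  \sum_(k <- lsupp p) f k (lcoef k p) = \sum_(k <- d) f k (lcoef k p).
Proof.
move=> f0 le_d; apply: big_fset_incl => // k _ /lcoef_out ->; exact: f0.
Qed.

Lemma lsupp_sumD (V : zmodType) (f : int -> {additive int -> V})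
    (p q : laurent) :
  \sum_(k <- lsupp (p + q)) f k (lcoef k (p + q)) =
  \sum_(k <- lsupp p) f k (lcoef k p) + \sum_(k <- lsupp q) f k (lcoef k q).
Proof.
have f0 k : f k 0 = 0 by rewrite raddf0.
pose F k c := f k c; have sumw := @lsupp_sumw _ F _ (lsupp p `|` lsupp q)%fset f0.
rewrite [LHS](sumw (p + q)) ?msuppD_le // [X in _ = X + _](sumw p) ?fsubsetUl //.
rewrite [X in _ = _ + X](sumw q) ?fsubsetUr //.
by rewrite -big_split /=; apply: eq_bigr => k _; rewrite /F !raddfD.
Qed.

Lemma lsupp_sumU (V : zmodType) (f : int -> {additive int -> V}) c k :
  \sum_(i <- lsupp (lmono k c)) f i (lcoef i (lmono k c)) = f k c.
Proof.
have f0 i : f i 0 = 0 by rewrite raddf0.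
rewrite (@lsupp_sumw _ (fun i c => f i c) _ [fset k]%fset) ?lsupp_mono_le // big_seq_fset1.
by rewrite lcoef_mono eqxx.
Qed.

Lemma lmulDl : left_distributive lmul +%R.
Proof.
move=> p q r; have h (i c : int) : zmod_morphism
    (fun c => \sum_(j <- lsupp r) lmono (i + j) (c * lcoef j r)).
  move=> a b; rewrite -sumrB; apply: eq_bigr => j _.
  by rewrite mulrBl raddfB.
pose f i : {additive int -> laurent} := HB.pack
  (fun c => \sum_(j <- lsupp r) lmono (i + j) (c * lcoef j r))
  (GRing.isZmodMorphism.Build _ _ _ (h i 0)).
rewrite unlock; exact: (lsupp_sumD f).
Qed.

Lemma lmulC : commutative lmul.
Proof.
move=> p q; rewrite unlock exchange_big /=; apply: eq_bigr => j _.
by apply: eq_bigr => i _; rewrite mulrC [i + j]addrC.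
Qed.

Lemma lmulDr : right_distributive lmul +%R.
Proof. by move=> p q r; rewrite lmulC lmulDl ![lmul _ p]lmulC. Qed.

Lemma lmul0p : left_zero 0 lmul.
Proof.
by move=> p; apply: (addrI (lmul 0 p)); rewrite -lmulDl !addr0.
Qed.

Lemma lmulUU a b i j : lmul (lmono i a) (lmono j b) = lmono (i + j) (a * b).
Proof.
rewrite unlock; under eq_bigr => k _.
  rewrite (@lsupp_sumw _ (fun l c => lmono (k + l) (lcoef k (lmono i a) * c)) _
      [fset j]%fset) ?lsupp_mono_le //; last by move=> l; rewrite mulr0 lmono0.
  rewrite big_seq_fset1; over.
rewrite (@lsupp_sumw _
  (fun k c => lmono (k + j) (c * lcoef j (lmono j b))) _ [fset i]%fset)
  ?lsupp_mono_le //; last by move=> l; rewrite mul0r lmono0.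
by rewrite big_seq_fset1 !lcoef_mono !eqxx.
Qed.

Lemma lmul1p : left_id (lmono 0 1) lmul.
Proof.
move=> p; elim/laurent_ind: p => [|p q IHp IHq|k c].
- by rewrite lmulC lmul0p.
- by rewrite lmulDr IHp IHq.
- by rewrite lmulUU mul1r add0r.
Qed.

Lemma lmulA : associative lmul.
Proof.
move=> p q r; elim/laurent_ind: p => [|p p' IHp IHp'|a i].
- by rewrite !lmul0p.
- by rewrite !lmulDl IHp IHp'.
elim/laurent_ind: q => [|q q' IHq IHq'|b j].
- by rewrite lmul0p [lmul _ 0]lmulC !lmul0p.
- by rewrite lmulDl !lmulDr lmulDl IHq IHq'.
elim/laurent_ind: r => [|r r' IHr IHr'|c k].
- by rewrite ![lmul _ 0]lmulC !lmul0p lmulC lmul0p.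
- by rewrite !lmulDr IHr IHr'.
- by rewrite !lmulUU mulrA addrA.
Qed.

Fact lone_neq0 : lmono 0 1 != 0.
Proof. by apply/eqP => /laurentP /(_ 0); rewrite lcoef_mono raddf0. Qed.

HB.instance Definition _ := GRing.Zmodule_isComNzRing.Build laurent
  lmulA lmulC lmul1p lmulDl lone_neq0.

Lemma lmonoM a b i j : lmono i a * lmono j b = lmono (i + j) (a * b).
Proof. exact: lmulUU. Qed.

(* Units are recognized and inverted by classical choice; a unit of Z[t, t^-1]
   is in fact some +t^k or -t^k. *)
Definition lunit : pred laurent := fun p => `[< exists q : laurent, q * p = 1 >].

Definition linv (p : laurent) : laurent :=
  if pselect (exists q : laurent, q * p = 1) is left h then projT1 (cid h)
  else p.

Fact lmulVp : {in lunit, left_inverse 1 linv *%R}.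
Proof.
move=> p /asboolP p_unit; rewrite /linv.
by case: pselect => // h; case: (cid h).
Qed.

Fact lunitPl (p q : laurent) : q * p = 1 -> lunit p.
Proof. by move=> qp1; apply/asboolP; exists q. Qed.

Fact linv_out : {in [predC lunit], linv =1 id}.
Proof.
by move=> p /asboolP p_nunit; rewrite /linv; case: pselect.
Qed.

HB.instance Definition _ := GRing.ComNzRing_hasMulInverse.Build laurent
  lmulVp lunitPl linv_out.

Definition tvar : laurent := lmono 1 1.

Lemma tvar_unit : tvar \is a GRing.unit.
Proof.
by apply/unitrPr; exists (lmono (- 1) 1); rewrite lmonoM mulr1 subrr.
Qed.

Lemma tvarX (k : int) : tvar ^ k = lmono k 1.
Proof.
have tX (n : nat) : tvar ^+ n = lmono n 1.
  elim: n => [//|n IHn].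
  by rewrite exprS IHn lmonoM mulr1 -intS.
case: k => n; first exact: tX.
apply: (mulIr (unitrX n.+1 tvar_unit)); rewrite NegzE.
by rewrite -exprnN mulVr ?unitrX ?tvar_unit // tX lmonoM mulr1 addNr.
Qed.

(* p(u) = \sum_k p_k u^k, meaningful when u is invertible *)
Definition lsubst (R : comUnitRingType) (u : R) (p : laurent) : R :=
  \sum_(k <- lsupp p) u ^ k *~ lcoef k p.

(* p(-t) *)
Definition subst_neg : laurent -> laurent := lsubst (- tvar).

Section SubstTheory.
Variables (R : comUnitRingType) (u : R).

Lemma lsubst_mono k c : lsubst u (lmono k c) = u ^ k *~ c.
Proof. exact: (lsupp_sumU (fun k => *~%R (u ^ k))). Qed.

Lemma lsubstD p q : lsubst u (p + q) = lsubst u p + lsubst u q.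
Proof. exact: (lsupp_sumD (fun k => *~%R (u ^ k))). Qed.

Fact lsubst_zmod_morphism : zmod_morphism (lsubst u).
Proof. by move=> p q; apply: (addIr (lsubst u q)); rewrite -lsubstD !subrK. Qed.

Fact lsubst_monoid_morphism :
  u \is a GRing.unit -> monoid_morphism (lsubst u).
Proof.
move=> u_unit; split=> [|p q]; first by rewrite lsubst_mono expr0z.
have s0 : lsubst u 0 = 0 by rewrite /lsubst big1_fset // => k; rewrite mem_lsupp raddf0.
elim/laurent_ind: p => [|p p' IHp IHp'|i a].
- by rewrite mul0r s0 mul0r.
- by rewrite mulrDl !lsubstD IHp IHp' mulrDl.
elim/laurent_ind: q => [|q q' IHq IHq'|j b].
- by rewrite mulr0 s0 mulr0.
- by rewrite mulrDr !lsubstD IHq IHq' mulrDr.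
rewrite lmonoM !lsubst_mono exprzDr //.
by rewrite mulrzAl mulrzAr -mulrzA [b * a]mulrC.
Qed.

End SubstTheory.

HB.instance Definition _ := GRing.isZmodMorphism.Build laurent laurent
  subst_neg (lsubst_zmod_morphism (- tvar)).

Fact subst_neg_monoid_morphism : monoid_morphism subst_neg.
Proof. by apply: lsubst_monoid_morphism; rewrite unitrN tvar_unit. Qed.

HB.instance Definition _ := GRing.isMonoidMorphism.Build laurent laurent
  subst_neg subst_neg_monoid_morphism.

Lemma subst_neg_tvar : subst_neg tvar = - tvar.
Proof. by rewrite /subst_neg lsubst_mono expr1z. Qed.

Lemma lcoef_subst_neg k p :
  lcoef k (subst_neg p) = (-1) ^+ `|k|%N * lcoef k p.
Proof.
elim/laurent_ind: p => [|p q IHp IHq|i c].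
- by rewrite !raddf0 mulr0.
- by rewrite !raddfD /= IHp IHq mulrDr.
have -> : subst_neg (lmono i c) = lmono i ((-1) ^+ `|i|%N * c).
  rewrite /subst_neg lsubst_mono -[- tvar]mulN1r.
  rewrite exprMz_comm ?unitrN1 ?tvar_unit ?tvarX //; last exact: mulrC.
  have -> : (-1 : laurent) ^ i = ((-1) ^+ `|i|%N)%:~R.
    rewrite rmorphXn rmorphN1; case: i => n //.
    by rewrite NegzE -exprnN -exprVn invrN1 abszN.
  by rewrite mulrzl -mulrzA -raddfMz intz.
by rewrite !lcoef_mono; case: eqP => [->|_] //; rewrite mulr0.
Qed.

Definition definite (p : laurent) : Prop :=
  forall i j, lcoef i p != 0 -> lcoef j p != 0 ->
    Num.sg (lcoef i p) = Num.sg (lcoef j p).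

(* The library's 'GL_n[R] requires R finite. *)
Record GL (n : nat) (R : comUnitRingType) := MkGL {
  GLmx :> 'M[R]_n;
  GLmxP : GLmx \in unitmx
}.

Section GLGroup.
Variables (n : nat) (R : comUnitRingType).
Local Notation GL := (GL n R).

HB.instance Definition _ := [isSub for @GLmx n R].
HB.instance Definition _ := [Choice of GL by <:].

Definition GL1 : GL := MkGL (unitmx1 R n).
Definition GLinv (A : GL) : GL :=
  MkGL (etrans (unitmx_inv A) (GLmxP A)).
Fact GLmul_subproof (A B : GL) : A *m B \in unitmx.
Proof. by rewrite unitmx_mul !GLmxP. Qed.
Definition GLmul (A B : GL) : GL := MkGL (GLmul_subproof A B).

Fact GLmulA : associative GLmul.
Proof. by move=> A B C; apply: val_inj; rewrite /= mulmxA. Qed.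
Fact GLmul1g : left_id GL1 GLmul.
Proof. by move=> A; apply: val_inj; rewrite /= mul1mx. Qed.
Fact GLmulg1 : right_id GL1 GLmul.
Proof. by move=> A; apply: val_inj; rewrite /= mulmx1. Qed.
Fact GLmulVg : left_inverse GL1 GLinv GLmul.
Proof. by move=> A; apply: val_inj; rewrite /= mulVmx ?GLmxP. Qed.
Fact GLmulgV : right_inverse GL1 GLinv GLmul.
Proof. by move=> A; apply: val_inj; rewrite /= mulmxV ?GLmxP. Qed.

HB.instance Definition _ :=
  isGroup.Build GL GLmulA GLmul1g GLmulg1 GLmulVg GLmulgV.

End GLGroup.

(* The letter (i, false) stands for sigma_(i+1) and (i, true) for its inverse;
   the group Br_3 is the quotient of the words by the least congruence that
   contains the free cancellations and the braid relation. *)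
Definition word := seq ('I_2 * bool).

Definition letter1 : 'I_2 * bool := (ord0, false).
Definition letter2 : 'I_2 * bool := (ord_max, false).

Inductive braid_eq : word -> word -> Prop :=
| braid_refl w : braid_eq w w
| braid_sym v w : braid_eq v w -> braid_eq w v
| braid_trans u v w : braid_eq u v -> braid_eq v w -> braid_eq u w
| braid_cat v v' w w' :
    braid_eq v v' -> braid_eq w w' -> braid_eq (v ++ w) (v' ++ w')
| braid_cancel i b : braid_eq [:: (i, b); (i, ~~ b)] [::]
| braid_braid : braid_eq [:: letter1; letter2; letter1]
                         [:: letter2; letter1; letter2].

Definition braid_eqb (v w : word) : bool := `[< braid_eq v w >].

Fact braid_eqb_refl : reflexive braid_eqb.
Proof. by move=> w; apply/asboolP/braid_refl. Qed.
Fact braid_eqb_sym : symmetric braid_eqb.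
Proof. by move=> v w; apply/asboolP/asboolP => /braid_sym. Qed.
Fact braid_eqb_trans : transitive braid_eqb.
Proof.
by move=> v u w /asboolP uv /asboolP vw; apply/asboolP/(braid_trans uv).
Qed.
Canonical braid_equiv :=
  EquivRel braid_eqb braid_eqb_refl braid_eqb_sym braid_eqb_trans.

Definition Br3 : Type := {eq_quot braid_equiv}%qT.
HB.instance Definition _ := Choice.on Br3.
HB.instance Definition _ : EqQuotient word braid_equiv Br3 :=
  EqQuotient.on Br3.

Definition braid_class (w : word) : Br3 := \pi_Br3%qT w.

Lemma braid_classP v w : braid_class v = braid_class w <-> braid_eq v w.
Proof.
split=> [/eqP|vw]; first by rewrite /braid_class piE => /asboolP.
by apply/eqP; rewrite /braid_class piE; apply/asboolP.
Qed.

Lemma repr_braidK (x : Br3) : braid_class (repr x) = x.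
Proof. exact: reprK. Qed.

Definition inv_word (w : word) : word := rev [seq (l.1, ~~ l.2) | l <- w].

Definition br_one : Br3 := braid_class [::].
Definition br_mul (x y : Br3) : Br3 := braid_class (repr x ++ repr y).
Definition br_inv (x : Br3) : Br3 := braid_class (inv_word (repr x)).

Lemma br_mulE v w : br_mul (braid_class v) (braid_class w) = braid_class (v ++ w).
Proof. by apply/braid_classP/braid_cat; apply/braid_classP/repr_braidK. Qed.

Lemma inv_wordK : involutive inv_word.
Proof.
move=> w; rewrite /inv_word map_rev revK -map_comp.
by rewrite -[RHS]map_id; apply: eq_map => -[i b] /=; rewrite negbK.
Qed.

Lemma braid_eq_mulV w : braid_eq (w ++ inv_word w) [::].
Proof.
elim: w => [|[i b] w IHw]; first exact: braid_refl.
rewrite /inv_word /= rev_cons -/(inv_word w) -cats1 catA.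
apply: (braid_trans _ (braid_cancel i b)).
exact: (braid_cat (braid_refl [:: (i, b)])
         (braid_cat IHw (braid_refl [:: (i, ~~ b)]))).
Qed.

Fact br_mulA : associative br_mul.
Proof.
move=> x y z; rewrite -[x]repr_braidK -[y]repr_braidK -[z]repr_braidK.
by rewrite !br_mulE catA.
Qed.
Fact br_mul1g : left_id br_one br_mul.
Proof. by move=> x; rewrite -[x]repr_braidK br_mulE. Qed.
Fact br_mulg1 : right_id br_one br_mul.
Proof. by move=> x; rewrite -[x]repr_braidK br_mulE cats0. Qed.
Fact br_mulgV : right_inverse br_one br_inv br_mul.
Proof.
move=> x; rewrite -{1}[x]repr_braidK br_mulE.
exact/braid_classP/braid_eq_mulV.
Qed.
Fact br_mulVg : left_inverse br_one br_inv br_mul.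
Proof.
move=> x; rewrite -{2}[x]repr_braidK br_mulE.
by apply/braid_classP; rewrite -{2}[repr x]inv_wordK; apply: braid_eq_mulV.
Qed.

HB.instance Definition _ :=
  isGroup.Build Br3 br_mulA br_mul1g br_mulg1 br_mulVg br_mulgV.

Lemma braid_classM v w :
  braid_class (v ++ w) = (braid_class v * braid_class w)%g.
Proof. by rewrite -br_mulE. Qed.

Definition sigma1 : Br3 := braid_class [:: letter1].
Definition sigma2 : Br3 := braid_class [:: letter2].

Lemma braid_relation :
  (sigma1 * sigma2 * sigma1 = sigma2 * sigma1 * sigma2)%g.
Proof.
rewrite /sigma1 /sigma2 -!braid_classM.
by apply/braid_classP; exact: braid_braid.
Qed.

Definition mx2 (a b c d : laurent) : 'M[laurent]_2 :=
  \matrix_(i < 2, j < 2) nth 0 (nth [::] [:: [:: a; b]; [:: c; d]] i) j.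

Lemma mulmx2 a b c d a' b' c' d' :
  mx2 a b c d *m mx2 a' b' c' d' =
  mx2 (a * a' + b * c') (a * b' + b * d') (c * a' + d * c') (c * b' + d * d').
Proof.
apply/matrixP => i j; rewrite !mxE !big_ord_recl big_ord0 !mxE /= addr0.
by case: i => [[|[|i]] Hi] //; case: j => [[|[|j]] Hj].
Qed.

Lemma mx2_1 : mx2 1 0 0 1 = 1%:M.
Proof.
apply/matrixP => i j; rewrite !mxE.
by case: i => [[|[|i]] Hi] //; case: j => [[|[|j]] Hj].
Qed.

Definition burau_mx1 : 'M[laurent]_2 := mx2 (- tvar) 1
                                            0        1.
Definition burau_mx2 : 'M[laurent]_2 := mx2 1    0
                                            tvar (- tvar).

Fact burau_mx1_unit : burau_mx1 \in unitmx.
Proof.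
have E : burau_mx1 *m (mx2 (- tvar^-1) tvar^-1 0 1) = 1%:M; last first.
  by have [-> _] := mulmx1_unit E.
rewrite /burau_mx1 mulmx2 mulrNN mulNr divrr ?tvar_unit // -mx2_1.
by rewrite !(mulr0, mul0r, mulr1, mul1r, addr0, add0r) addNr.
Qed.

Fact burau_mx2_unit : burau_mx2 \in unitmx.
Proof.
have E : burau_mx2 *m (mx2 1 0 1 (- tvar^-1)) = 1%:M; last first.
  by have [-> _] := mulmx1_unit E.
rewrite /burau_mx2 mulmx2 mulrNN divrr ?tvar_unit // -mx2_1.
by rewrite !(mulr0, mul0r, mulr1, mul1r, addr0, add0r) subrr.
Qed.

Definition burau_gen (i : 'I_2) : GL 2 laurent :=
  if i == ord0 then MkGL burau_mx1_unit else MkGL burau_mx2_unit.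

Definition burau_letter (l : 'I_2 * bool) : GL 2 laurent :=
  (if l.2 then (burau_gen l.1)^-1 else burau_gen l.1)%g.

Definition burau_word (w : word) : GL 2 laurent :=
  (\prod_(l <- w) burau_letter l)%g.

(* B_t *)
Definition burau (x : Br3) : GL 2 laurent := burau_word (repr x).

Lemma burau_word_eq v w : braid_eq v w -> burau_word v = burau_word w.
Proof.
rewrite /burau_word; elim=> {v w} //.
- by move=> u v w _ -> _ ->.
- by move=> v v' w w' _ IHv _ IHw; rewrite !big_cat /= IHv IHw.
- move=> i b; rewrite !big_cons big_nil mulg1 /burau_letter /=.
  by case: b; rewrite ?mulVg ?mulgV.
rewrite !big_cons big_nil !mulg1 /burau_letter /burau_gen /=.
apply: val_inj => /=; rewrite !mulmx2.
congr mx2; ring.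
Qed.

Lemma burauE w : burau (braid_class w) = burau_word w.
Proof. by apply/burau_word_eq/braid_classP/repr_braidK. Qed.

Lemma burauM x y : burau (x * y)%g = (burau x * burau y)%g.
Proof.
rewrite -[x]repr_braidK -[y]repr_braidK -braid_classM !burauE.
by rewrite /burau_word big_cat.
Qed.

Fact burau_group_morphism : {morph burau : x y / (x / y)%g}.
Proof.
by move=> x y; apply: (mulIg (burau y)); rewrite -burauM !mulgVK.
Qed.

HB.instance Definition _ :=
  isGroupMorphism.Build Br3 (GL 2 laurent) burau burau_group_morphism.

Lemma burau_sigma1 : GLmx (burau sigma1) = burau_mx1.
Proof. by rewrite burauE /burau_word big_seq1. Qed.

Lemma burau_sigma2 : GLmx (burau sigma2) = burau_mx2.
Proof. by rewrite burauE /burau_word big_seq1. Qed.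

(* B_(-t) *)
Definition burau_neg (x : Br3) : 'M[laurent]_2 := map_mx subst_neg (burau x).

(* Main.v *)
Require Import Defs.
From mathcomp Require Import all_boot all_order all_algebra.
From mathcomp Require Import ring.

(** Specialized at [-t], the generator [sigma1] and the inverse of [sigma2]
    act, up to a power of [t], by the matrices

      R = (t 1; 0 1)    and    L = (t 0; t 1),

    whose entries have nonnegative coefficients; these are the q-deformed
    standard generators of the monoid of nonnegative matrices in SL_2(Z).  So
    every product of [R]s and [L]s has nonnegative entries.  The half twist
    [sigma1 sigma2 sigma1] acts by D = (0 t; -t^2 0), whose square is a scalar
    monomial, and multiplication by [D] on either side only permutes the
    entries and multiplies them by monomials.

    The point is then that every braid acts, up to a monomial scalar, by
    D^a P D^b with a, b in {0, 1} and P a product of [R]s and [L]s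
    ([normal_form_burau]).  This is the q-analogue of the fact that, up to the
    quarter turn on each side, every element of PSL_2(Z) has nonnegative
    entries.  It follows from the relations

      R D R = - t^2 L,   L D L = t^2 R,   R D L = L D R = t D,

    which absorb a [D] standing between two letters, together with the
    observation that [D] and [R] generate, up to monomial scalars, the images
    of the generators and of their inverses.

    Definiteness of the entries is immediate from the normal form.  For the
    trace, the cyclic invariance and the scalar D^2 leave two cases, tr P and
    tr (D P).  The first is a sum of two entries with nonnegative coefficients.
    The second is the only place where signs could mix; there the last letter
    of P is moved cyclically in front of D, and the relations above either
    turn tr (D P) into a monomial multiple of the trace of a product of [R]s
    and [L]s, or shorten P by two letters ([definite_trace_half_twist]). *)

Set Implicit Arguments.
Unset Strict Implicit.
Unset Printing Implicit Defensive.

Import Order.TTheory GRing.Theory Num.Theory.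
Local Open Scope ring_scope.

(** * Signs of coefficients *)

Definition nonneg (p : laurent) : Prop := forall i, 0 <= lcoef i p.

Lemma lcoef_monoM k c p i : lcoef i (lmono k c * p) = c * lcoef (i - k) p.
Proof.
elim/laurent_ind: p => [|p q IHp IHq|j d].
- by rewrite mulr0 !raddf0 mulr0.
- by rewrite mulrDr !raddfD /= IHp IHq mulrDr.
by rewrite lmonoM !lcoef_mono mulrnAr [j == _]eq_sym subr_eq eq_sym addrC.
Qed.

Lemma nonneg_mono k c : 0 <= c -> nonneg (lmono k c).
Proof. by move=> c0 i; rewrite lcoef_mono mulrn_wge0. Qed.

Lemma nonnegD p q : nonneg p -> nonneg q -> nonneg (p + q).
Proof. by move=> p0 q0 i; rewrite raddfD addr_ge0 ?p0 ?q0. Qed.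

Lemma nonneg_tvarM p : nonneg p -> nonneg (tvar * p).
Proof. by move=> p0 i; rewrite lcoef_monoM mul1r. Qed.

Lemma nonneg_definite p : nonneg p -> definite p.
Proof.
move=> p0 i j pi pj.
by rewrite !gtr0_sg // lt_def ?pi ?pj p0.
Qed.

Lemma definite_monoM k c p : definite p -> definite (lmono k c * p).
Proof.
move=> dp i j; rewrite !lcoef_monoM !mulf_eq0 !negb_or => /andP[_ pi] /andP[_ pj].
by rewrite !sgrM (dp _ _ pi pj).
Qed.

Lemma definite_mono k c : definite (lmono k c).
Proof.
rewrite -[lmono k c]mulr1; apply/definite_monoM/nonneg_definite.
exact: nonneg_mono.
Qed.

(** * The matrices of the monoid and of the half twist *)

Definition mxR : 'M[laurent]_2 := mx2 tvar 1 0 1.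
(** [t] times the image of the inverse of [sigma2]; the factor clears the
    denominator. *)
Definition mxL : 'M[laurent]_2 := mx2 tvar 0 tvar 1.
Definition mxD : 'M[laurent]_2 := mx2 0 tvar (- tvar ^+ 2) 0.

Lemma scale_mx2 x a b c d :
  x *: mx2 a b c d = mx2 (x * a) (x * b) (x * c) (x * d).
Proof.
apply/matrixP => i j; rewrite !mxE.
by case: i => [[|[|i]] Hi] //; case: j => [[|[|j]] Hj].
Qed.

Lemma mul_mx2 a b c d a' b' c' d' :
  mx2 a b c d * mx2 a' b' c' d' =
  mx2 (a * a' + b * c') (a * b' + b * d') (c * a' + d * c') (c * b' + d * d').
Proof. exact: mulmx2. Qed.

Lemma mx2_eta (A : 'M[laurent]_2) :
  A = mx2 (A ord0 ord0) (A ord0 ord_max) (A ord_max ord0) (A ord_max ord_max).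
Proof.
apply/matrixP => i j; rewrite !mxE.
by case: i => [[|[|i]] Hi] //; case: j => [[|[|j]] Hj] //=;
  congr (A _ _); apply: val_inj.
Qed.

Lemma mxDD : mxD * mxD = (- tvar ^+ 3) *: 1.
Proof. by rewrite -[1]mx2_1 mul_mx2 scale_mx2; congr mx2; ring. Qed.

Lemma mxRDR : mxR * mxD * mxR = (- tvar ^+ 2) *: mxL.
Proof. by rewrite !mul_mx2 scale_mx2; congr mx2; ring. Qed.

Lemma mxLDL : mxL * mxD * mxL = tvar ^+ 2 *: mxR.
Proof. by rewrite !mul_mx2 scale_mx2; congr mx2; ring. Qed.

Lemma mxRDL : mxR * mxD * mxL = tvar *: mxD.
Proof. by rewrite !mul_mx2 scale_mx2; congr mx2; ring. Qed.

Lemma mxLDR : mxL * mxD * mxR = tvar *: mxD.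
Proof. by rewrite !mul_mx2 scale_mx2; congr mx2; ring. Qed.

Definition mxRL (s : seq bool) : 'M[laurent]_2 :=
  \prod_(x <- s) if x then mxR else mxL.

Lemma mxRL_cons x s : mxRL (x :: s) = (if x then mxR else mxL) * mxRL s.
Proof. exact: big_cons. Qed.

Lemma mxRL_rcons x s : mxRL (rcons s x) = mxRL s * if x then mxR else mxL.
Proof. by rewrite /mxRL -cats1 big_cat big_seq1. Qed.

(** * The normal form *)

(** The scalar is an arbitrary integral monomial rather than a unit, which
    avoids tracking signs and is harmless: multiplication by a monomial
    preserves definiteness. *)
Definition normal_form (A : 'M[laurent]_2) : Prop :=
  exists k c s (a b : bool), A = lmono k c *: (mxD ^+ a * mxRL s * mxD ^+ b).

Lemma tvarXE n : tvar ^+ n = lmono n 1.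
Proof. exact: (tvarX n). Qed.

Lemma NtvarXE n : - tvar ^+ n = lmono n (-1).
Proof. by rewrite tvarXE raddfN. Qed.

Lemma normal_formZ k c A : normal_form A -> normal_form (lmono k c *: A).
Proof.
move=> [l [d [s [a [b ->]]]]]; exists (k + l), (c * d), s, a, b.
by rewrite scalerA lmonoM.
Qed.

Lemma normal_form_mulD A : normal_form A -> normal_form (mxD * A).
Proof.
move=> [k [c [s [a [b ->]]]]]; rewrite -scalerAr; apply: normal_formZ.
case: a; last by exists 0, 1, s, true, b; rewrite scale1r expr0 mul1r !mulrA.
rewrite expr1 !mulrA mxDD -!scalerAl mul1r NtvarXE.
by exists 3, (-1), s, false, b; rewrite mul1r.
Qed.

(** Left multiplication by [R] meets either a word, which it lengthens, or a
    [D].  In the latter case [R D] followed by the next letter is a monomial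
    multiple of a single letter or of [D]; if the word is empty, the [D] is
    handed over to the right-hand power of [D]. *)
Lemma normal_form_mulR A : normal_form A -> normal_form (mxR * A).
Proof.
move=> [k [c [s [a [b ->]]]]]; rewrite -scalerAr; apply: normal_formZ.
case: a; last first.
  by exists 0, 1, (true :: s), false, b; rewrite scale1r mxRL_cons !mul1r mulrA.
rewrite expr1; case: s => [|[] s].
- rewrite /mxRL big_nil mulr1; case: b.
    rewrite expr1 mxDD -scalerAr NtvarXE.
    by exists 3, (-1), [:: true], false, false; rewrite /mxRL big_seq1 mul1r.
  by exists 0, 1, [:: true], false, true; rewrite /mxRL big_seq1 scale1r mul1r mulr1.
- rewrite mxRL_cons !mulrA mxRDR -!scalerAl NtvarXE.
  by exists 2, (-1), (false :: s), false, b; rewrite mxRL_cons mul1r.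
rewrite mxRL_cons !mulrA mxRDL -!scalerAl.
by exists 1, 1, s, true, b.
Qed.

(** [L] is a monomial multiple of [R D R]. *)
Lemma normal_form_mulL A : normal_form A -> normal_form (mxL * A).
Proof.
move=> nA; have -> : mxL * A = lmono (- 2) (-1) *: (mxR * (mxD * (mxR * A))).
  by rewrite !mulrA mxRDR -scalerAl scalerA NtvarXE lmonoM scale1r.
by apply/normal_formZ/normal_form_mulR/normal_form_mulD/normal_form_mulR.
Qed.

Lemma burau_negM x y : burau_neg (x * y)%g = burau_neg x * burau_neg y.
Proof. by rewrite /burau_neg burauM map_mxM. Qed.

Lemma burau_neg1 : burau_neg 1%g = 1.
Proof. by rewrite /burau_neg gmulf1 map_mx1. Qed.

Lemma map_mx2 (f : laurent -> laurent) a b c d :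
  map_mx f (mx2 a b c d) = mx2 (f a) (f b) (f c) (f d).
Proof.
apply/matrixP => i j; rewrite !mxE.
by case: i => [[|[|i]] Hi] //; case: j => [[|[|j]] Hj].
Qed.

Lemma burau_neg_sigma1 : burau_neg sigma1 = mxR.
Proof.
by rewrite /burau_neg burau_sigma1 map_mx2 rmorphN /= subst_neg_tvar opprK
           rmorph0 !rmorph1.
Qed.

Lemma burau_neg_sigma2 : burau_neg sigma2 = lmono (- 3) (-1) *: (mxD * mxR * mxD).
Proof.
have -> : mxD * mxR * mxD = (- tvar ^+ 3) *: mx2 1 0 (- tvar) tvar.
  by rewrite !mul_mx2 scale_mx2; congr mx2; ring.
rewrite scalerA NtvarXE lmonoM scale1r /burau_neg burau_sigma2 map_mx2.
by rewrite rmorphN /= subst_neg_tvar opprK rmorph0 !rmorph1.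
Qed.

Lemma burau_negV x A : A * burau_neg x = 1 -> burau_neg x^-1%g = A.
Proof.
move=> Ax; rewrite -[LHS]mul1r -Ax -mulrA -burau_negM mulgV burau_neg1.
exact: mulr1.
Qed.

Lemma burau_neg_sigma1V :
  burau_neg sigma1^-1%g = lmono (- 4) (-1) *: (mxD * mxL * mxD).
Proof.
apply: burau_negV; rewrite burau_neg_sigma1 -scalerAl -!mulrA [mxL * _]mulrA mxLDR.
rewrite -scalerAr mxDD !scalerA NtvarXE.
by rewrite !lmonoM scale1r.
Qed.

Lemma burau_neg_sigma2V : burau_neg sigma2^-1%g = lmono (- 1) 1 *: mxL.
Proof.
apply: burau_negV; rewrite burau_neg_sigma2 -scalerAl -scalerAr !mulrA mxLDR.
by rewrite -scalerAl mxDD !scalerA NtvarXE !lmonoM scale1r.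
Qed.

Lemma braid_class_letter i b :
  braid_class [:: (i, b)] =
  (let s := if i == ord0 then sigma1 else sigma2 in if b then s^-1 else s)%g.
Proof.
have E : (if i == ord0 then sigma1 else sigma2) = braid_class [:: (i, false)].
  case: eqP => [->//|]; case: i => [[|[|i]] Hi] // ne0.
    by case: ne0; apply: val_inj.
  by congr (braid_class [:: (_, _)]); apply: val_inj.
rewrite E; case: b => //=; apply/esym; rewrite -[LHS]mulg1.
apply/(mulgI (braid_class [:: (i, false)])); rewrite mulg1 mulgV -braid_classM.
by apply/esym/braid_classP; apply: braid_cancel.
Qed.

Lemma normal_form_burau w : normal_form (burau_neg w).
Proof.
rewrite -[w]repr_braidK; elim: (repr w) => [|[i b] v IHv].
  rewrite burau_neg1; exists 0, 1, [::], false, false.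
  by rewrite /mxRL big_nil scale1r !mulr1.
rewrite -cat1s braid_classM burau_negM braid_class_letter /=.
have nD := normal_form_mulD; have nR := normal_form_mulR.
have nL := normal_form_mulL; have nZ := normal_formZ.
case: b; case: (i == ord0).
- by rewrite burau_neg_sigma1V -scalerAl -!mulrA; auto.
- by rewrite burau_neg_sigma2V -scalerAl; auto.
- by rewrite burau_neg_sigma1; auto.
- by rewrite burau_neg_sigma2 -scalerAl -!mulrA; auto.
Qed.

(** * Definiteness of the entries and of the trace *)

Definition definite_mx (A : 'M[laurent]_2) : Prop :=
  forall i j, definite (A i j).

Lemma mx2_entries (Q : laurent -> Prop) a b c d :
  Q a -> Q b -> Q c -> Q d -> forall i j, Q (mx2 a b c d i j).
Proof.
move=> Qa Qb Qc Qd i j; rewrite mxE.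
by case: i => [[|[|i]] Hi] //; case: j => [[|[|j]] Hj].
Qed.

Lemma nonneg_mxRL s i j : nonneg (mxRL s i j).
Proof.
elim: s i j => [|x s IHs].
  by rewrite /mxRL big_nil -[1]mx2_1 -(lmono0 0); apply: mx2_entries; apply: nonneg_mono.
rewrite mxRL_cons [mxRL s]mx2_eta.
by case: x; rewrite mul_mx2 !(mul0r, mul1r, add0r, addr0);
  apply: mx2_entries; do ?[exact: IHs | apply: nonnegD | apply: nonneg_tvarM].
Qed.

Lemma definite_mxD_l A : definite_mx A -> definite_mx (mxD * A).
Proof.
move=> dA; rewrite [A]mx2_eta mul_mx2 !(mul0r, add0r, addr0) NtvarXE.
by apply: mx2_entries; apply: definite_monoM.
Qed.

Lemma definite_mxD_r A : definite_mx A -> definite_mx (A * mxD).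
Proof.
move=> dA; rewrite [A]mx2_eta mul_mx2 !(mulr0, add0r, addr0) NtvarXE.
by apply: mx2_entries; rewrite mulrC; apply: definite_monoM.
Qed.

Lemma tr_mx2 a b c d : \tr (mx2 a b c d) = a + d.
Proof. by rewrite /mxtrace !big_ord_recl big_ord0 !mxE addr0. Qed.

Lemma definite_trace_mxRL s : definite (\tr (mxRL s)).
Proof.
apply: nonneg_definite; rewrite [mxRL s]mx2_eta tr_mx2.
by apply: nonnegD; apply: nonneg_mxRL.
Qed.

(** Writing the word as [x s y], the trace of [D x s y] is that of
    [(y D x) s].  If [x] and [y] are the same letter, [y D x] is a monomial
    multiple of the other letter, so no half twist is left; if they differ,
    it is a multiple of [D] and the shorter word [s] remains. *)
Lemma definite_trace_half_twist s : definite (\tr (mxD * mxRL s)).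
Proof.
have [n] := ubnP (size s); elim: n s => // n IHn [|x s] /=.
  move=> _; rewrite /mxRL big_nil mulr1 tr_mx2 addr0.
  by rewrite -(lmono0 0); apply: definite_mono.
case/lastP: s => [|s y].
  (* tr (D R) = - t^2 and tr (D L) = t^2. *)
  move=> _; rewrite /mxRL big_seq1; case: x; rewrite mul_mx2 tr_mx2.
    rewrite !(mul0r, mulr0, mulr1, add0r, addr0) NtvarXE; exact: definite_mono.
  by rewrite !(mul0r, mulr0, mulr1, add0r, addr0) lmonoM; apply: definite_mono.
rewrite size_rcons ltnS => /ltnW lt_s_n; rewrite mxRL_cons mxRL_rcons.
rewrite !mulrA [\tr _]mxtrace_mulC -[_ *m _]/(_ * _) !mulrA.
have Z (k c : int) (A : 'M[laurent]_2) :
    definite (\tr A) -> definite (\tr (lmono k c *: A)).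
  by move=> dA; rewrite mxtraceZ; apply: definite_monoM.
case: x; case: y; rewrite ?(mxRDR, mxRDL, mxLDR, mxLDL) -scalerAl ?NtvarXE ?tvarXE.
- by apply: Z; have := @definite_trace_mxRL (false :: s); rewrite mxRL_cons.
- exact/Z/IHn.
- exact/Z/IHn.
- by apply: Z; have := @definite_trace_mxRL (true :: s); rewrite mxRL_cons.
Qed.

Theorem theorem1p4 (w : Br3) :
  (forall i j : 'I_2, definite (burau_neg w i j)) /\ definite (\tr (burau_neg w)).
Proof.
have [k [c [s [a [b ->]]]]] := normal_form_burau w.
split=> [i j|].
  rewrite mxE; apply: definite_monoM.
  have dP : definite_mx (mxRL s).
    by move=> ? ?; apply/nonneg_definite/nonneg_mxRL.
  by case: a; case: b; rewrite ?expr1 ?expr0 ?mulr1 ?mul1r;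
    do ?[apply: definite_mxD_r | apply: definite_mxD_l].
rewrite mxtraceZ; apply: definite_monoM.
case: a; case: b; rewrite ?expr1 ?expr0 ?mulr1 ?mul1r.
- rewrite [\tr _]mxtrace_mulC -[_ *m _]/(_ * _) mulrA mxDD -scalerAl mul1r.
  by rewrite mxtraceZ NtvarXE; apply/definite_monoM/definite_trace_mxRL.
- exact: definite_trace_half_twist.
- rewrite [\tr _]mxtrace_mulC; exact: definite_trace_half_twist.
- exact: definite_trace_mxRL.
Qed.
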